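(* Let $n \ge 2$ be an integer. For $1\le i,j\le n$ let $E_{ij}$ denote the $n\times n$ matrix whose $(i,j)$ entry is $1$ and whose other entries are $0$, and let $a_{ij} = (j-1)\,n^{i-2}$ for $2\le i,j\le n$. Consider the following $n^2$ matrices in $\mathbb{R}^{n\times n}$: the $2n-1$ matrices $E_{ij}$ with $i = 1$ or $j = 1$; the $(n-1)^2-1$ matrices $E_{ij} - a_{ij}E_{22}$ with $i,j\ge 2$ and $(i,j)\ne(2,2)$; and the matrix $E_{22}$. These matrices form a unimodular basis of $\mathbb{R}^{n\times n}$ (that is, a basis of the lattice $\mathbb{Z}^{n\times n}$), and when the Birkhoff polytope $B_n$ is written in coordinates with respect to this basis, with the coordinate along $E_{22}$ taken as the first coordinate, the resulting polytope in $\mathbb{R}^{n^2}$ is in $1$-general position.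
   Context: The $n$th Birkhoff polytope $B_n \subset \mathbb{R}^{n\times n}$ is the convex hull of the set of nonnegative real $n \times n$ matrices whose rows and columns all sum to $1$. Let $\pi^{(k)}\colon \mathbb{R}^D \to \mathbb{R}^k$ be the projection $(x_1,\ldots,x_D)\mapsto(x_1,\ldots,x_k)$. An affine subspace $U \subset \mathbb{R}^D$ is in general position if $\pi^{(\dim U)}(U) = \mathbb{R}^{\dim U}$. A polytope is in affinely general position if its affine hull is in general position. A polytope is in $k$-general position if all of its (nonempty) faces of dimension at most $k$ are in affinely general position. *)

(* Defs.v *)
From HB Require Import structures.
From mathcomp Require Import all_boot all_order all_algebra.
From mathcomp Require Import boolp classical_sets reals convex.
Set Implicit Arguments.
Unset Strict Implicit.
Unset Printing Implicit Defensive.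
Import Order.TTheory GRing.Theory Num.Theory.
Local Open Scope classical_set_scope.
Local Open Scope ring_scope.

Definition convex_hull (R : realType) (V : lmodType R) (A : set V) : set V :=
  smallest (@convex_set R V) A.

Definition doubly_stochastic (R : realType) (n : nat) : set 'M[R]_n :=
  [set A | [/\ forall i j, 0 <= A i j,
               forall i, \sum_j A i j = 1
             & forall j, \sum_i A i j = 1]].

Definition birkhoff (R : realType) (n : nat) : set 'M[R]_n :=
  convex_hull (@doubly_stochastic R n).
Arguments birkhoff : clear implicits.

(* Affine subspaces are nonempty here: U = p + W with W a linear subspace, *)
(* and the dimension d of U is that of W.                                  *)
Definition affine_subspace_dim (R : realType) (D : nat) (d : nat)
    (U : set 'rV[R]_D) : Prop :=
  exists (p : 'rV[R]_D) (W : {vspace 'rV[R]_D}),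
    \dim W = d /\ U = [set x | x - p \in W].

Definition affine_subspace (R : realType) (D : nat) (U : set 'rV[R]_D) : Prop :=
  exists d, affine_subspace_dim d U.

Definition affine_hull (R : realType) (D : nat) (A : set 'rV[R]_D) :
    set 'rV[R]_D :=
  smallest (@affine_subspace R D) A.

Definition proj (R : realType) (D k : nat) (hk : (k <= D)%N) (x : 'rV[R]_D) :
    'rV[R]_k :=
  \row_i x 0 (widen_ord hk i).

Definition in_general_position (R : realType) (D : nat) (U : set 'rV[R]_D) :
    Prop :=
  exists d (hd : (d <= D)%N),
    affine_subspace_dim d U /\ proj hd @` U = [set: 'rV[R]_d].

Definition in_affinely_general_position (R : realType) (D : nat)
    (P : set 'rV[R]_D) : Prop :=
  in_general_position (affine_hull P).

(* Faces of a polytope P are its intersections with the hyperplanes f = m   *)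
(* for valid inequalities f <= m; f = 0 gives P itself and the empty face.  *)
Definition face (R : realType) (D : nat) (P F : set 'rV[R]_D) : Prop :=
  exists (f : {scalar 'rV[R]_D}) (m : R),
    (forall x, P x -> f x <= m) /\ F = P `&` [set x | f x = m].

Definition in_k_general_position (R : realType) (D k : nat)
    (P : set 'rV[R]_D) : Prop :=
  forall (F : set 'rV[R]_D) (d : nat),
    face P F -> F !=set0 -> affine_subspace_dim d (affine_hull F) ->
    (d <= k)%N -> in_affinely_general_position F.

(* A basis of R^{m x n} whose integer span is the lattice Z^{m x n}; linear *)
(* independence over Z follows from that over R.                            *)
Definition unimodular_basis (R : realType) (m n k : nat)
    (b : k.-tuple 'M[R]_(m, n)) : Prop :=
  basis_of fullv b /\
  forall A : 'M[R]_(m, n),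
    A \is a mxOver Num.int <->
    exists c : 'I_k -> int, A = \sum_(i < k) tnth b i *~ c i.

Definition coordinates (R : realType) (m n k : nat)
    (b : k.-tuple 'M[R]_(m, n)) (A : 'M[R]_(m, n)) : 'rV[R]_k :=
  \row_i coord b i A.

(* Takes indices i, j counted from 1. *)
Definition a_coef (n i j : nat) : nat := ((j - 1) * n ^ (i - 2))%N.

(* Ordinals count from 0: [Ordinal hn] is the index written 2 when rows and *)
(* columns are numbered from 1.                                             *)
Definition E22 (R : realType) (n : nat) (hn : (2 <= n)%N) : 'M[R]_n :=
  delta_mx (Ordinal hn) (Ordinal hn).

(* The basis element attached to (i, j): E_ij when i = 1 or j = 1 or        *)
(* (i, j) = (2, 2), and E_ij - a_ij E_22 otherwise (indices from 1).        *)
Definition basis_mx (R : realType) (n : nat) (hn : (2 <= n)%N)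
    (ij : 'I_n * 'I_n) : 'M[R]_n :=
  if [|| ij.1 == 0%N :> nat, ij.2 == 0%N :> nat
       | ij == (Ordinal hn, Ordinal hn)]
  then delta_mx ij.1 ij.2
  else delta_mx ij.1 ij.2 - (a_coef n ij.1.+1 ij.2.+1)%:R *: E22 R hn.

(* Main.v *)
Require Import Defs.
From HB Require Import structures.
From mathcomp Require Import all_boot all_order all_algebra.
From mathcomp Require Import boolp classical_sets reals convex.
From mathcomp Require Import interval_inference fingroup perm zify lra.
Set Implicit Arguments.
Unset Strict Implicit.
Unset Printing Implicit Defensive.
Import Order.TTheory GRing.Theory Num.Theory.
Local Open Scope classical_set_scope.
Local Open Scope ring_scope.

(** Unimodularity holds because each [E_ij] differs from its basis element by
    a nonnegative integer multiple of [E_22], itself a basis element: the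
    [n^2] basis elements generate every [E_ij] over the integers.

    For the general position, only the faces whose affine hull is a point or a
    line matter, and points are trivial.  A line is in general position as
    soon as the first coordinate is not constant on it, so it suffices to find
    two points of the hull where the first coordinates differ.  Undoing the
    change of basis, the first coordinate of a matrix [A] is the sum over
    [i >= 2] and all [j] of [(j - 1) n^(i-2) A_ij].  At the permutation matrix
    of [s] this is the number whose digits in base [n] are the values of [s]
    on the rows from the second on; the digits determine these values, and
    the value of [s] on the first row is then the only one left.  Hence the
    first coordinate separates permutation matrices
    ([coord_perm_mx], [digit_weight_perm_inj]).

    It remains to see that a face of the Birkhoff polytope with two distinct
    points contains two distinct permutation matrices ([face_two_perm_mx]).
    By Hall's theorem the support of a doubly stochastic matrix [A] contains
    the graph of a permutation [s], and if [A] is not itself a permutation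
    matrix then [A = t P_s + (1 - t) B] with [0 < t < 1] and [B] doubly
    stochastic and zero at some entry [(i, s i)].  A linear form that attains
    its maximum at [A] attains it at [P_s] and at [B], and a permutation in the
    support of [B] cannot be [s]: peeling once yields the second vertex. *)

(** * Hall's marriage theorem *)

Local Notation nbhd S X := (\bigcup_(i in X) S i)%SET.

(** If removing [x] and removing [y] both broke Hall's condition, violators [X]
    and [Y] would both contain [i].  The union of their neighbourhoods contains
    all of [S i], since [x != y], hence the original neighbourhood of [X :|: Y];
    the intersection contains that of [(X :&: Y) :\ i].  Counting then gives
    [#|X :|: Y| + #|X :&: Y| - 1 <= (#|X| - 1) + (#|Y| - 1)], which is
    absurd. *)
Lemma rado_step (I T : finType) (S : I -> {set T}) (i : I) (x y : T) :
    (forall X : {set I}, #|X| <= #|nbhd S X|)%N -> x != y ->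
  exists2 z, z \in [set x; y]%SET &
    forall X : {set I},
      (#|X| <= #|nbhd (fun k => if k == i then S i :\ z else S k) X|)%N.
Proof.
move=> hall xy; pose S' z k := if k == i then (S i :\ z)%SET else S k.
have [/forallP hx|/forallPn/=[X]] :=
    boolP [forall X : {set I}, (#|X| <= #|nbhd (S' x) X|)%N].
  by exists x => //; rewrite !inE eqxx.
have [/forallP hy _|/forallPn/=[Y]] :=
    boolP [forall X : {set I}, (#|X| <= #|nbhd (S' y) X|)%N].
  by exists y => //; rewrite !inE eqxx orbT.
rewrite -!ltnNge.
set U := nbhd (S' x) X; set V := nbhd (S' y) Y => VY UX; exfalso.
have inviol z (Z : {set I}) : (#|nbhd (S' z) Z| < #|Z|)%N -> i \in Z.
  apply: contraTT => iZ; rewrite -leqNgt.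
  suff -> : nbhd (S' z) Z = nbhd S Z by apply: hall.
  apply: eq_bigr => k kZ; rewrite /S' ifN //.
  by apply: contraNneq iZ => <-.
have iX := inviol _ _ UX; have iY := inviol _ _ VY.
have sub1 : nbhd S (X :|: Y)%SET \subset U :|: V.
  apply/finset.bigcupsP => k; rewrite inE; have [->{k} _|ki kXY] := eqVneq k i.
    apply/fintype.subsetP => u uS; rewrite inE; have [ux|ux] := eqVneq u x.
      apply/orP; right; apply/finset.bigcupP; exists i => //.
      by rewrite /S' eqxx !inE uS ux xy.
    apply/orP; left; apply/finset.bigcupP; exists i => //.
    by rewrite /S' eqxx !inE uS ux.
  have SE z : S k = S' z k by rewrite /S' (negPf ki).
  case/orP: kXY => kZ.
    by rewrite (SE x) subsetU // [X in X || _](finset.bigcup_sup k).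
  by rewrite (SE y) subsetU // [X in _ || X](finset.bigcup_sup k) // orbT.
have sub2 : nbhd S ((X :&: Y) :\ i)%SET \subset U :&: V.
  apply/finset.bigcupsP => k; rewrite !inE => /and3P[ki kX kY].
  have SE z : S k = S' z k by rewrite /S' (negPf ki).
  rewrite finset.subsetI {1}(SE x) (SE y); apply/andP.
  by split; apply: finset.bigcup_sup.
have := leq_trans (hall _) (subset_leq_card sub1).
have := leq_trans (hall _) (subset_leq_card sub2).
have := finset.cardsUI U V; have := finset.cardsUI X Y.
have := cardsD1 i (X :&: Y)%SET; rewrite inE iX iY /=.
move: UX VY; lia.
Qed.

(** Rado's proof: shrink the sets [S i] one element at a time, keeping Hall's
    condition, until all are singletons; the condition on pairs then says that
    these singletons are distinct. *)
Theorem hall_marriage (I T : finType) (S : I -> {set T}) :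
    (forall X : {set I}, #|X| <= #|nbhd S X|)%N ->
  exists2 f : I -> T, injective f & forall i, f i \in S i.
Proof.
have [m] := ubnP (\sum_i #|S i|)%N; elim: m S => // m IH S Sm hall.
have [/existsP[i /card_gt1P[x [y [xS yS xy]]]]|/existsPn S1] :=
    boolP [exists i, (1 < #|S i|)%N].
  have [z zxy hallz] := rado_step i hall xy.
  have zS : z \in S i by move: zxy; rewrite !inE => /orP[]/eqP->.
  have [|f finj fS] := IH _ _ hallz.
    rewrite (bigD1 i) //= eqxx.
    move: Sm; rewrite (bigD1 i) //= [in X in (X < _)%N](cardsD1 z) zS /=.
    rewrite [in X in (_ < _)%N -> X](eq_bigr (fun k => #|S k|)).
      lia.
    by move=> k /negPf ->.
  exists f => // k; have := fS k; case: eqP => // ->.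
  by rewrite !inE => /andP[].
have /(_ _)/cards1P/cid Sf i : #|S i| == 1%N.
  rewrite eqn_leq leqNgt S1 /=.
  by have := hall [set i]%SET; rewrite cards1 big_set1.
exists (fun i => sval (Sf i)) => [i j fij|i]; last first.
  by case: (Sf i) => /= x ->; rewrite inE.
apply/eqP/negPn/negP => ij.
have := hall [set i; j]%SET; rewrite finset.cards2 ij.
have Sij : S j = S i.
  by move: fij; case: (Sf i) => /= x ->; case: (Sf j) => /= y -> ->.
suff -> : nbhd S [set i; j]%SET = S i.
  by case: (Sf i) => /= x ->; rewrite cards1.
by rewrite finset.bigcup_setU !big_set1 Sij finset.setUid.
Qed.

(** * Doubly stochastic matrices and the faces of the Birkhoff polytope *)

Section Birkhoff.
Variables (R : realType) (n : nat).
Implicit Types (A B : 'M[R]_n) (s : 'S_n).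

Lemma birkhoffE : birkhoff R n = @doubly_stochastic R n.
Proof.
apply: smallest_id => A B t /set_mem[A0 Ar Ac] /set_mem[B0 Br Bc]; apply: mem_set.
have t0 : 0 <= t%:num by [].
have t1 : 0 <= 1 - t%:num by rewrite subr_ge0.
split=> [i j|i|j].
- by rewrite !mxE addr_ge0 // mulr_ge0.
- under eq_bigr do rewrite !mxE.
  by rewrite big_split /= -!mulr_sumr Ar Br !mulr1 addrC subrK.
- under eq_bigr do rewrite !mxE.
  by rewrite big_split /= -!mulr_sumr Ac Bc !mulr1 addrC subrK.
Qed.

Lemma perm_mx_entry s i j : (perm_mx s : 'M[R]_n) i j = (s i == j)%:R.
Proof. by rewrite !mxE. Qed.

Lemma perm_mx_doubly_stochastic s : doubly_stochastic (perm_mx s : 'M[R]_n).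
Proof.
split=> [i j|i|j]; first by rewrite perm_mx_entry ler0n.
- rewrite (bigD1 (s i)) //= perm_mx_entry eqxx big1 ?addr0 // => j ji.
  by rewrite perm_mx_entry eq_sym (negPf ji).
- rewrite (bigD1 (s^-1%g j)) //= perm_mx_entry permKV eqxx big1 ?addr0 // => i.
  by rewrite perm_mx_entry (can2_eq (permK s) (permKV s)) => /negPf ->.
Qed.

(** Hall's condition for the support of [A]: the rows in [X] have total mass
    [#|X|], all of it in the columns of the neighbourhood of [X], each of which
    has total mass 1. *)
Lemma doubly_stochastic_diagonal A :
  doubly_stochastic A -> exists s, forall i, 0 < A i (s i).
Proof.
move=> [A0 Ar Ac]; pose S i := [set j | 0 < A i j]%SET.
have [X|f finj fS] := @hall_marriage _ _ S; last first.
  by exists (perm finj) => i; rewrite permE; have := fS i; rewrite inE.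
rewrite -(ler_nat R) -!sum1_card !natr_sum.
have -> : \sum_(i in X) 1%:R = \sum_(i in X) \sum_(j in nbhd S X) A i j.
  apply: eq_bigr => i iX; rewrite -(Ar i) [LHS](bigID (mem (nbhd S X))) /=.
  rewrite [X in _ + X]big1 ?addr0 // => j jS.
  apply/eqP; rewrite eq_le A0 andbT leNgt.
  by apply: contra jS => Aij; apply/finset.bigcupP; exists i => //; rewrite inE.
rewrite exchange_big /=; apply: ler_sum => j _.
by rewrite -(Ac j) [leRHS](bigID (mem X)) /= lerDl sumr_ge0.
Qed.

(** The weight [t] is the least of the entries [A i (s i)]: it is the largest
    multiple of the permutation matrix that can be subtracted while keeping
    nonnegative entries, so the remainder vanishes at some [(i, s i)]. *)
Lemma doubly_stochastic_peel A s :
    doubly_stochastic A -> (forall i, 0 < A i (s i)) -> A <> perm_mx s ->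
  exists t B, [/\ 0 < t < 1, doubly_stochastic B,
    A = t *: perm_mx s + (1 - t) *: B & exists i, B i (s i) = 0].
Proof.
move=> [A0 Ar Ac] As AneP.
have [i0 _|n0] := pickP (@predT 'I_n); last first.
  by case: AneP; apply/matrixP => i; case/negP: (n0 i).
have [i _ imin] := arg_minP (fun i => A i (s i)) (erefl (predT i0)).
have rowD j : A j (s j) + \sum_(k | k != s j) A j k = 1.
  by rewrite -(Ar j) [RHS](bigD1 (s j)).
have le1 j : A j (s j) <= 1 by rewrite -(rowD j) lerDl sumr_ge0.
set t := A i (s i) in imin *.
have t0 : 0 < t by exact: As.
(* If the least entry on the graph of s is 1, each row sum is exhausted there. *)
have t1 : t < 1.
  rewrite lt_neqAle le1 andbT; apply/eqP => t1; apply: AneP.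
  apply/matrixP => j k; rewrite perm_mx_entry.
  have Aj : A j (s j) = 1 by apply/eqP; rewrite eq_le le1 -t1 imin.
  have [<-//|sjk] := eqVneq (s j) k.
  have /eqP := rowD j; rewrite Aj -subr_eq0 addrC addKr.
  rewrite psumr_eq0 // => /allP/(_ k); rewrite mem_index_enum eq_sym sjk /=.
  by move=> /(_ isT)/eqP.
have u0 : 0 < 1 - t by rewrite subr_gt0.
have [_ Pr Pc] := perm_mx_doubly_stochastic s.
have entryE (c d : R) (C P : 'M[R]_n) j k :
    (c *: (C - d *: P)) j k = c * (C j k - d * P j k) by rewrite !mxE.
exists t, ((1 - t)^-1 *: (A - t *: perm_mx s)); split.
- by rewrite t0.
- split=> [j k|j|k].
  + rewrite entryE perm_mx_entry mulr_ge0 ?invr_ge0 ?(ltW u0) // subr_ge0.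
    by case: eqP => [<-|_]; rewrite ?mulr1 ?imin // mulr0.
  + under eq_bigr do rewrite entryE.
    by rewrite -mulr_sumr sumrB -mulr_sumr Ar Pr mulr1 mulVf ?gt_eqF.
  + under eq_bigr do rewrite entryE.
    by rewrite -mulr_sumr sumrB -mulr_sumr Ac Pc mulr1 mulVf ?gt_eqF.
- by rewrite scalerA divff ?gt_eqF // scale1r addrC subrK.
- by exists i; rewrite entryE perm_mx_entry eqxx mulr1 subrr mulr0.
Qed.

(** Here [f <= m] is a valid inequality, and the matrices with [f = m] form a
    face. *)
Section Face.
Variables (f : 'M[R]_n -> R) (m : R).
Hypotheses (flin : scalar f) (fm : forall A, doubly_stochastic A -> f A <= m).

(** Unless [A] is the permutation matrix itself, [m] is a convex combination,
    with positive weights, of the values of [f] at the permutation matrix and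
    at the remainder, both at most [m]. *)
Lemma face_perm_mx A s :
    doubly_stochastic A -> f A = m -> (forall i, 0 < A i (s i)) ->
  f (perm_mx s) = m.
Proof.
move=> Ads fA As; have [<-//|/eqP AneP] := eqVneq A (perm_mx s).
have [t [B [/andP[t0 t1] Bds AE _]]] := doubly_stochastic_peel Ads As AneP.
have fP := fm (perm_mx_doubly_stochastic s); have fB := fm Bds.
apply/eqP; rewrite eq_le fP /=.
have f0 : f 0 = 0 by have := flin (-1) 0 0; rewrite scaler0 addr0; lra.
move: fA; rewrite AE flin -[_ *: B]addr0 flin f0 addr0.
by nra.
Qed.

(** Peel off [s] once: the remainder [B] vanishes at some [(i, s i)], so a
    permutation in its support differs from [s]; that permutation is also in
    the support of [A], hence in the face. *)
Lemma face_other_perm_mx A s :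
    doubly_stochastic A -> f A = m -> (forall i, 0 < A i (s i)) ->
    A <> perm_mx s ->
  exists2 s', s' != s & f (perm_mx s') = m.
Proof.
move=> Ads fA As AneP.
have [t [B [/andP[t0 t1] Bds AE [i Bi]]]] := doubly_stochastic_peel Ads As AneP.
have [s' Bs'] := doubly_stochastic_diagonal Bds.
exists s'; first by apply: contraTneq (Bs' i) => ->; rewrite Bi ltxx.
apply: (face_perm_mx Ads fA) => j; rewrite AE mxE mxE [X in _ + X]mxE.
rewrite ltr_wpDl ?mulr_gt0 ?subr_gt0 // mulr_ge0 ?(ltW t0) //.
by rewrite perm_mx_entry.
Qed.

Lemma face_two_perm_mx A B :
    doubly_stochastic A -> doubly_stochastic B -> f A = m -> f B = m ->
    A <> B ->
  exists s s', [/\ s != s', f (perm_mx s) = m & f (perm_mx s') = m].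
Proof.
move=> Ads Bds fA fB AB.
have [s As] := doubly_stochastic_diagonal Ads.
have [s' Bs'] := doubly_stochastic_diagonal Bds.
have fs := face_perm_mx Ads fA As; have fs' := face_perm_mx Bds fB Bs'.
have [ss'|] := eqVneq s s'; last by exists s, s'.
have [AE|/eqP AneP] := eqVneq A (perm_mx s).
  have [|u us fu] := face_other_perm_mx Bds fB Bs'; last by exists u, s'.
  by rewrite -ss' -AE => BA; apply: AB.
have [u us fu] := face_other_perm_mx Ads fA As AneP.
by exists u, s.
Qed.

End Face.
End Birkhoff.

(** * General position of points and lines *)

Section AffineHull.
Variables (R : realType) (D : nat).
Implicit Types (U F : set 'rV[R]_D).

Lemma affine_dim0_general_position U :
  affine_subspace_dim 0 U -> in_general_position U.
Proof.
move=> U0; exists 0%N, (leq0n D); split=> //.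
have [p [W [_ UE]]] := U0; apply/seteqP; split=> // y _.
exists p; first by rewrite UE /= subrr mem0v.
by apply/rowP; case.
Qed.

(** The affine parametrization [x + c (x - y)] of the line reaches every value
    of the first coordinate. *)
Lemma affine_dim1_general_position U x y (hD : (0 < D)%N) :
    affine_subspace_dim 1 U -> U x -> U y ->
    x 0 (Ordinal hD) != y 0 (Ordinal hD) ->
  in_general_position U.
Proof.
move=> U1 + + xy; have [p [W [_ UE]]] := U1; rewrite {1 2}UE /= => xW yW.
exists 1%N, hD; split=> //; apply/seteqP; split=> // z _.
have d0 : x 0 (Ordinal hD) - y 0 (Ordinal hD) != 0 by rewrite subr_eq0.
pose c := (z 0 0 - x 0 (Ordinal hD)) / (x 0 (Ordinal hD) - y 0 (Ordinal hD)).
exists (x + c *: (x - y)).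
  rewrite UE /= addrAC memvD // memvZ //.
  by rewrite -[x](subrK p) -addrA -[p - y]opprB memvB.
apply/rowP => i; rewrite ord1 !mxE.
have -> : widen_ord hD 0 = Ordinal hD by apply: val_inj.
by rewrite /c divfK // addrC subrK.
Qed.

(** The hull of a single point is contained in that point, while a line
    [p + W] contains [p] and [p + w] for a nonzero [w] in [W]. *)
Lemma affine_hull_dim1_two_points F :
    F !=set0 -> affine_subspace_dim 1 (affine_hull F) ->
  exists x y, [/\ F x, F y & x <> y].
Proof.
move=> [x Fx] [p [W [W1 FE]]].
have [[y [Fy xy]]|Fx1] := pselect (exists y, F y /\ x <> y).
  by exists x, y.
have hullx : affine_hull F `<=` [set x].
  apply: smallest_sub.
    exists 0%N, x, 0%VS; split; first by rewrite dimv0.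
    by apply/seteqP; split=> y /=; rewrite memv0 subr_eq0 => /eqP.
  by move=> y Fy /=; apply: contrapT => yx; apply: Fx1; exists y; split => // /esym.
rewrite FE in hullx.
have px : p = x by apply: hullx; rewrite /= subrr mem0v.
have : p + vpick W = x by apply: hullx; rewrite /= addrC addKr memv_pick.
rewrite -px -[RHS]addr0 => /addrI/eqP; rewrite vpick0 => /eqP W0.
by move: W1; rewrite W0 dimv0.
Qed.

End AffineHull.

(** * Permutations as numbers in base n *)

Lemma digits_inj (n m : nat) (d e : 'I_m -> nat) :
    (forall i, d i < n)%N -> (forall i, e i < n)%N ->
    (\sum_(i < m) d i * n ^ i = \sum_(i < m) e i * n ^ i)%N ->
  d =1 e.
Proof.
elim: m d e => [|m IH] d e dn en; first by move=> _ [].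
have sumE (g : 'I_m.+1 -> nat) : (\sum_(i < m.+1) g i * n ^ i =
    (\sum_(i < m) g (lift ord0 i) * n ^ i) * n + g ord0)%N.
  rewrite big_ord_recl muln1 addnC big_distrl /=; congr (_ + _)%N.
  by apply: eq_bigr => i _; rewrite expnSr mulnA.
rewrite !sumE => sum_eq.
have de0 : d ord0 = e ord0.
  have := congr1 (modn^~ n) sum_eq.
  by rewrite /= !modnMDl !modn_small.
have n0 : (0 < n)%N by apply: leq_ltn_trans (dn ord0).
move: sum_eq; rewrite de0 => /addIn/eqP; rewrite eqn_pmul2r // => /eqP sum_eq.
move=> i; case: (unliftP ord0 i) => [j|] -> //.
exact: (IH (d \o lift ord0) (e \o lift ord0) (fun=> dn _) (fun=> en _) sum_eq).
Qed.

(** The first coordinate of [E_ij] in the new basis, with indices counted from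
    0: it is [a_coef] away from row 0, but row 0 has weight 0, whereas the
    truncated exponent of [a_coef] would give [n^0] there. *)
Definition digit_weight (n i j : nat) : nat :=
  if i is i'.+1 then (j * n ^ i')%N else 0%N.

(** The digits recover [s] on all rows but row 0, and bijectivity forces the
    remaining value. *)
Lemma digit_weight_perm_inj (n : nat) :
  injective (fun s : 'S_n => \sum_(i < n) digit_weight n i (s i))%N.
Proof.
case: n => [|n] s t; first by move=> _; apply/permP; case.
rewrite /= !big_ord_recl /= => /addnI /digits_inj st.
have {}st i : s (lift ord0 i) = t (lift ord0 i).
  by apply: val_inj; apply: st => k /=.
apply/permP => i; case: (unliftP ord0 i) => [j|] -> //.
(* The preimage k of t 0 under s is row 0: elsewhere s k = t k. *)
pose k := s^-1%g (t ord0).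
have sk : s k = t ord0 by rewrite /k permKV.
case: (unliftP ord0 k) sk => [j|] -> //.
by rewrite st => /perm_inj.
Qed.

(** * The unimodular basis and its first coordinate *)

Section Basis.
Variables (R : realType) (n : nat) (hn : (2 <= n)%N).
Local Notation o1 := (Ordinal hn).

Lemma delta_mx_basis (i j : 'I_n) : (i, j) != (o1, o1) ->
  delta_mx i j = basis_mx R hn (i, j) + (digit_weight n i j)%:R *: E22 R hn.
Proof.
rewrite /basis_mx /= => /negPf ->; rewrite orbF.
case: (i : nat) => [|i'] /=; first by rewrite scale0r addr0.
rewrite /a_coef !subSS !subn0; case: eqP => [->|_] /=.
  by rewrite mul0n scale0r addr0.
by rewrite subrK.
Qed.

Lemma basis_mx_E22 : basis_mx R hn (o1, o1) = E22 R hn.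
Proof. by rewrite /basis_mx eqxx !orbT. Qed.

(** Expanded by [delta_mx_basis], an equality would make [E_ij] a multiple of
    [E_22], which fails at the entry [(i, j)]. *)
Lemma basis_mx_neq_E22 ij : ij != (o1, o1) -> basis_mx R hn ij != E22 R hn.
Proof.
case: ij => i j ij; apply/eqP => E.
have := congr1 (fun A : 'M[R]_n => A i j) (delta_mx_basis ij).
rewrite E /E22; have oij : ((i == o1) && (j == o1)) = false.
  by apply/negbTE; move: ij; rewrite xpair_eqE.
by rewrite !mxE !eqxx oij mulr0 addr0 => /eqP; rewrite oner_eq0.
Qed.

Variable b : (n ^ 2).-tuple 'M[R]_n.
Hypothesis hb : perm_eq b [seq basis_mx R hn ij | ij : 'I_n * 'I_n].

Lemma mem_basis_mx ij : basis_mx R hn ij \in b.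
Proof. by rewrite (perm_mem hb) fintype.image_f. Qed.

Lemma basis_mx_int ij : basis_mx R hn ij \is a mxOver Num.int.
Proof.
apply/mxOverP => k l; rewrite /basis_mx.
by case: ifP => _; rewrite !mxE ?rpredB ?rpredM ?rpred_nat.
Qed.

(** There are as many matrices as the dimension, so spanning suffices for a
    basis.  Integer combinations are handled through closure properties of the
    set [L] of all of them, independently of the order of [b]. *)
Lemma unimodular_basis_mx : unimodular_basis b.
Proof.
split.
  rewrite basisEdim size_tuple dimvf /= /dim /= mulnn leqnn andbT.
  apply/subvP => A _; rewrite (matrix_sum_delta A).
  apply: memv_suml => i _; apply: memv_suml => j _; apply: memvZ.
  have spanb ij : basis_mx R hn ij \in <<b>>%VS by rewrite memv_span ?mem_basis_mx.
  have [[-> ->]|ij] := eqVneq (i, j) (o1, o1); first by rewrite -[delta_mx _ _]basis_mx_E22.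
  by rewrite delta_mx_basis // memvD // memvZ // -basis_mx_E22.
move=> A; split=> [/mxOverP Aint|[c ->]]; last first.
  apply/mxOverP => i j; rewrite summxE rpred_sum // => k _.
  have := mem_tnth k b; rewrite (perm_mem hb) => /mapP[ij _ ->].
  by rewrite -scaler_int mxE rpredM ?(mxOverP (basis_mx_int ij)) ?intr_int.
pose L (B : 'M[R]_n) := exists c : 'I_(n ^ 2) -> int, B = \sum_i tnth b i *~ c i.
have L0 : L 0 by exists (fun=> 0); rewrite big1.
have LD B C : L B -> L C -> L (B + C).
  move=> [c ->] [d ->]; exists (fun i => c i + d i).
  by rewrite -big_split; apply: eq_bigr => i _; rewrite mulrzDr.
have LM B (z : int) : L B -> L (B *~ z).
  move=> [c ->]; exists (fun i => c i * z).
  by rewrite mulrz_suml; apply: eq_bigr => i _; rewrite mulrzA.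
have Lb ij : L (basis_mx R hn ij).
  have /tnthP[k ->] := mem_basis_mx ij; exists (fun i => (i == k)%:Z).
  rewrite (bigD1 k) //= eqxx big1 ?addr0 // => i /negPf -> //.
have Ldelta i j : L (delta_mx i j).
  have [[-> ->]|ij] := eqVneq (i, j) (o1, o1).
    by rewrite -[delta_mx _ _]basis_mx_E22; exact: Lb.
  rewrite delta_mx_basis //; apply: LD; first exact: Lb.
  by rewrite -basis_mx_E22 scaler_nat; apply: (LM _ (digit_weight n i j)).
rewrite -/(L A) (matrix_sum_delta A).
elim/big_ind: _ => // i _; elim/big_ind: _ => // j _.
have /intrP[z ->] := Aint i j.
by rewrite scaler_int; apply: LM.
Qed.

Hypothesis hb0 : b`_0 = E22 R hn.
(** [o0] is the index of the coordinate along [E_22]. *)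
Variable o0 : 'I_(n ^ 2).
Hypothesis o00 : o0 = 0%N :> nat.

Lemma coord_basis_mx ij : coord b o0 (basis_mx R hn ij) = (ij == (o1, o1))%:R.
Proof.
have /andP[_ freeb] := unimodular_basis_mx.1.
have /(nthP 0)[k kn kE] := mem_basis_mx ij; rewrite size_tuple in kn.
have := coord_free (Ordinal kn) o0 freeb; rewrite /= kE => ->.
congr (nat_of_bool _)%:R; have [ijE|ijE] := eqVneq ij (o1, o1).
  have ub := free_uniq freeb.
  rewrite -val_eqE /= o00.
  rewrite -(nth_uniq 0 _ _ ub) ?size_tuple ?(leq_ltn_trans _ kn) //.
  by rewrite kE hb0 ijE basis_mx_E22 eqxx.
apply: contraNF (basis_mx_neq_E22 ijE) => /eqP/(congr1 val) /= ko0.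
by rewrite -kE ko0 o00 hb0.
Qed.

Lemma coord_delta_mx i j :
  coord b o0 (delta_mx i j : 'M[R]_n) = (digit_weight n i j)%:R.
Proof.
have E22c : coord b o0 (E22 R hn) = 1.
  by rewrite -basis_mx_E22 coord_basis_mx eqxx.
have [[-> ->]|ij] := eqVneq (i, j) (o1, o1); first by rewrite E22c /= mul1n.
rewrite delta_mx_basis // linearD linearZ /= E22c coord_basis_mx (negPf ij).
by rewrite add0r mulr1.
Qed.

Lemma coord_perm_mx (s : 'S_n) :
  coord b o0 (perm_mx s : 'M[R]_n) = (\sum_(i < n) digit_weight n i (s i))%:R.
Proof.
have -> : (perm_mx s : 'M[R]_n) = \sum_i delta_mx i (s i).
  apply/matrixP => i j; rewrite perm_mx_entry summxE (bigD1 i) //= big1.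
    by rewrite mxE eqxx addr0 /= eq_sym.
  by move=> k ki; rewrite mxE eq_sym (negPf ki).
by rewrite linear_sum natr_sum /=; apply: eq_bigr => i _; rewrite coord_delta_mx.
Qed.

End Basis.

(* b lists the n^2 matrices in any order that puts E_22 first. *)
Theorem mainTheorem2 (R : realType) (n : nat) (hn : (2 <= n)%N)
    (b : (n ^ 2).-tuple 'M[R]_n)
    (hb : perm_eq b [seq basis_mx R hn ij | ij : 'I_n * 'I_n])
    (hb0 : b`_0 = E22 R hn) :
  unimodular_basis b /\
  in_k_general_position 1 (coordinates b @` birkhoff R n).
Proof.
split=> [|F d [f [m [fm FE]]] Fn0 dimF]; first exact: unimodular_basis_mx hb.
case: d dimF => [|[|//]] dimF _; first exact: affine_dim0_general_position.
rewrite birkhoffE in fm FE.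
pose g (A : 'M[R]_n) := f (coordinates b A).
have glin : scalar g.
  move=> a A B; rewrite /g -[RHS](linearP f); congr (f _).
  by apply/rowP => i; rewrite !mxE linearP.
have gm A : doubly_stochastic A -> g A <= m by move=> Ads; apply: fm; exists A.
have [x [y [+ + xy]]] := affine_hull_dim1_two_points Fn0 dimF.
rewrite {1 2}FE => -[[A Ads Ax] /= fx] [[B Bds By] /= fy].
have AB : A <> B by move=> AB; apply: xy; rewrite -Ax -By AB.
have [s [t [st gs gt]]] : exists s t : 'S_n,
    [/\ s != t, g (perm_mx s) = m & g (perm_mx t) = m].
  by apply: (face_two_perm_mx glin gm Ads Bds) => //; rewrite /g ?Ax ?By.
have hD : (0 < n ^ 2)%N by rewrite expn_gt0 (ltnW hn).
have hullP (u : 'S_n) : g (perm_mx u) = m ->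
    affine_hull F (coordinates b (perm_mx u)).
  move=> gu; apply: sub_gen_smallest; rewrite FE; split=> //.
  by exists (perm_mx u) => //; exact: perm_mx_doubly_stochastic.
apply: (affine_dim1_general_position dimF (hullP s gs) (hullP t gt) (hD := hD)).
rewrite !mxE !(coord_perm_mx hb hb0) // eqr_nat.
by apply: contraNneq st => /digit_weight_perm_inj ->.
Qed.
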